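(* Let $\mathcal{G}=(\mathcal{N},\mathcal{E})$ be the velocity graph and $\mathcal{G}_{mp}=(\mathcal{N}_{mp},\mathcal{E}_{mp})$ a motion primitive graph, as defined in the context, where the edges of $\mathcal{G}_{mp}$ are solutions of the order-$p$ optimal control problem (P) with $p\ge 2$, and where for each axis $i\in\{x,y,z\}$ the input bound $u_{max,i}$ of the minimum-time double integrator problem (D) is the maximum possible acceleration achievable in that axis under the constraint $c(\boldsymbol{a})\le 0$ of (P). Then the optimal cost-to-go $V_d^*$ of the minimum-time input-constrained double integrator problem on $\mathcal{G}$ is an admissible heuristic for the motion primitive search on $\mathcal{G}_{mp}$: setting $h(n)=V_d^*(\pi(n))$ for $n\in\mathcal{N}_{mp}$, one has $$h(n)\le h^*(n)\qquad\text{for all } n\in\mathcal{N}_{mp},$$ where $h^*(n)$ is the optimal cost in $\mathcal{G}_{mp}$ from $n$ to the goal.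
   Context: **Problem (D), minimum-time double integrator (one axis).** Given $(s_0,v_0),(s_f,v_f)\in\mathbb{R}^2$ and a bound $u_{max}>0$, minimize the free final time $T\ge 0$ subject to $\ddot s=u$, $|u|\le u_{max}$, $s(0)=s_0$, $\dot s(0)=v_0$, $s(T)=s_f$, $\dot s(T)=v_f$. For motion in $\mathbb{R}^3$, with boundary positions $\boldsymbol{r}_0,\boldsymbol{r}_f\in\mathbb{R}^3$, boundary velocities $\boldsymbol{v}_0,\boldsymbol{v}_f\in\mathbb{R}^3$ and per-axis bounds $u_{max,x},u_{max,y},u_{max,z}$, solve (D) separately in each axis to get minimum times $T_x,T_y,T_z$ and set $T_d^*=\max\{T_x,T_y,T_z\}$. **Problem (P), order $p\ge2$.** For a trajectory $\boldsymbol{r}:[0,T]\to\mathbb{R}^3$ with velocity $\boldsymbol{v}=\dot{\boldsymbol{r}}$ and acceleration $\boldsymbol{a}=\ddot{\boldsymbol{r}}$, $$\min_{T,\boldsymbol{u}}\ J=\rho T+\int_0^T q(\boldsymbol{r},\boldsymbol{v},\dots,\boldsymbol{u})\,dt$$ subject to $\boldsymbol{r}^{(p)}=\boldsymbol{u}$; $c(\boldsymbol{a})\le0$ along the trajectory; $\boldsymbol{r}(0)=\boldsymbol{r}_0$, $\boldsymbol{v}(0)=\boldsymbol{v}_0$, $\dots$, $\boldsymbol{r}^{(p-1)}(0)=\boldsymbol{r}^{(p-1)}_0$; $\boldsymbol{r}(T)=\boldsymbol{r}_f$, $\boldsymbol{v}(T)=\boldsymbol{v}_f$; and $\boldsymbol{r}^{(k-1)}(T)$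 free for $3\le k\le p$. Here $\rho>1$ is a constant, $q$ is a positive definite (in particular nonnegative) function, and $c$ is a given function of the acceleration. Controls are measurable and $\boldsymbol{r}^{(p-1)}$ is absolutely continuous; pointwise constraints hold for almost every $t$. ''$u_{max,i}$ is the maximum possible acceleration achievable in axis $i$'' means $u_{max,i}=\max\{|a_i| : c(\boldsymbol{a})\le0\}$, assumed finite and positive. **Velocity graph $\mathcal{G}$.** Given ordered waypoints $\boldsymbol{w}_1,\dots,\boldsymbol{w}_N\in\mathbb{R}^3$, a node is a pair (waypoint, velocity): there is a single start node $n_s$ at $\boldsymbol{w}_1$ with a given velocity, a single goal node $n_g$ at $\boldsymbol{w}_N$ with a given velocity, and finitely many sampled velocities at each intermediate waypoint. There is a directed edge $e$ from every node $n$ at $\boldsymbol{w}_i$ to every node $\phi(n,e)$ at $\boldsymbol{w}_{i+1}$, with cost $\ell(n,e)=T_d^*(n,e)$, the time $T_d^*$ of problem (D) for the boundary positions and velocities given by $n$ and $\phi(n,e)$. The optimal cost-to-go $V_d^*:\mathcal{N}\to\mathbb{R}_+$ is defined by $V_d^*(n_g)=0$ and the Bellman equation $V_d^*(n)=\min_{e}\{\ell(n,e)+V_d^*(\phi(n,e))\}$, the minimum being over edges leaving $n$. **Motion primitive graph $\mathcal{G}_{mp}$.** A finite directed graph whose nodes are state vectors (position, velocity, acceleration, ..., $(p-1)$-th derivative) at waypoints, the position-velocity part $\pi(n)$ of each node $n\in\mathcal{N}_{mp}$ being a node of $\mathcal{G}$. Every edge goes from a node $n$ at a waypoint $\boldsymbol{w}_i$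 to a node $n'$ at $\boldsymbol{w}_{i+1}$ and is an optimal solution of (P) whose initial conditions are the state of $n$ and whose terminal position and velocity are those of $n'$; its cost is the optimal value of $J$. The optimal cost $h^*(n)$ is the minimum total edge cost over paths in $\mathcal{G}_{mp}$ from $n$ to a node whose position-velocity part is $n_g$ (zero if $\pi(n)=n_g$, and $+\infty$ if no such path exists). **Admissible heuristic.** A function $h$ on the nodes such that $h(n)\le h^*(n)$ for all nodes $n$, where $h^*(n)$ is the optimal cost from $n$ to the goal. *)

(* Defs.v *)
From HB Require Import structures.
From mathcomp Require Import all_boot all_order all_algebra.
From mathcomp Require Import all_classical all_reals all_analysis.

Set Implicit Arguments.
Unset Strict Implicit.
Unset Printing Implicit Defensive.

Import Order.TTheory GRing.Theory Num.Theory.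
Import numFieldNormedType.Exports.

Local Open Scope classical_set_scope.
Local Open Scope ring_scope.

Definition is_minimum (R : realType) (A : set R) (m : R) : Prop :=
  A m /\ lbound A m.

Definition is_maximum (R : realType) (A : set R) (m : R) : Prop :=
  A m /\ ubound A m.

Definition absolutely_continuous (R : realType) (a b : R) (f : R -> R) : Prop :=
  forall e : R, 0 < e -> exists2 d : R, 0 < d &
    forall (n : nat) (l r : 'I_n -> R),
      (forall i, a <= l i /\ l i <= r i /\ r i <= b) ->
      trivIset setT (fun i => `]l i, r i[%classic) ->
      \sum_(i < n) (r i - l i) < d ->
      \sum_(i < n) `|f (r i) - f (l i)| < e.

(* A scalar trajectory of the order-p system s^(p) = u on [0, T] is encoded by
   the family x of its successive derivatives: x k = s^(k) for k < p, and
   x p = u is the control.  The entries x k with p < k are meaningless.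
   Continuity on the closed interval together with differentiability inside it
   yields the one-sided derivatives at 0 and T. *)
Definition integrator_chain (R : realType) (p : nat) (T : R)
    (x : nat -> R -> R) : Prop :=
  [/\ forall k, (k < p)%N -> {within `[0, T], continuous (x k)},
      forall k (t : R), (k.+1 < p)%N -> 0 < t < T ->
        is_derive t 1 (x k) (x k.+1 t),
      absolutely_continuous 0 T (x p.-1),
      measurable_fun `[0, T] (x p) &
      {ae (@lebesgue_measure R), forall t : R, 0 < t < T ->
        is_derive t 1 (x p.-1) (x p t)} ].

Definition double_integrator_time (R : realType) (umax s0 v0 sf vf T : R)
    : Prop :=
  0 <= T /\ exists x : nat -> R -> R,
    [/\ integrator_chain 2 T x,
        {ae (@lebesgue_measure R), forall t : R, 0 <= t <= T ->
          `|x 2%N t| <= umax},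
        x 0%N 0 = s0 /\ x 1%N 0 = v0 &
        x 0%N T = sf /\ x 1%N T = vf ].

(* For 0 < umax the double integrator is controllable in finite time, so this
   is the infimum of a nonempty set of nonnegative reals. *)
Definition min_time (R : realType) (umax s0 v0 sf vf : R) : R :=
  inf [set T | double_integrator_time umax s0 v0 sf vf T].

Lemma min_timeE (R : realType) (umax s0 v0 sf vf T : R) :
  is_minimum [set T' | double_integrator_time umax s0 v0 sf vf T'] T ->
  min_time umax s0 v0 sf vf = T.
Proof.
move=> [fT lT]; apply/eqP; rewrite eq_le; apply/andP; split.
  by apply: ge_inf => //; exists T.
by apply: lb_le_inf => //; exists T.
Qed.

(* Minimum times are nonnegative, so the base value 0 of the maximum is
   harmless. *)
Definition min_time3 (R : realType) (umax : 'I_3 -> R)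
    (r0 v0 rf vf : 'rV[R]_3) : R :=
  \big[Num.max/0]_(i < 3)
    min_time (umax i) (r0 0 i) (v0 0 i) (rf 0 i) (vf 0 i).

Definition positive_definite (R : realType) (m n : nat)
    (q : 'M[R]_(m, n) -> R) : Prop :=
  q 0 = 0 /\ forall z, z != 0 -> 0 < q z.

Section OptimalControl.
Context {R : realType} (p : nat).

(* x k = r^(k), so that x 0, x 1, x 2 and x p are the position, the velocity,
   the acceleration and the control; for p = 2 the acceleration is the
   control.  Row k of x0 prescribes r^(k)(0). *)
Definition ocp_feasible (c : 'rV[R]_3 -> R) (x0 : 'M[R]_(p, 3))
    (rf vf : 'rV[R]_3) (T : R) (x : nat -> R -> 'rV[R]_3) : Prop :=
  [/\ 0 <= T,
      forall i : 'I_3, integrator_chain p T (fun k t => x k t 0 i),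
      {ae (@lebesgue_measure R), forall t : R, 0 <= t <= T -> c (x 2%N t) <= 0},
      forall k : 'I_p, x k 0 = row k x0 &
      x 0%N T = rf /\ x 1%N T = vf ].

(* The rows of the argument of q are r, r', ..., r^(p-1), u. *)
Definition ocp_cost (rho : R) (q : 'M[R]_(p.+1, 3) -> R) (T : R)
    (x : nat -> R -> 'rV[R]_3) : \bar R :=
  ((rho * T)%:E +
   \int[@lebesgue_measure R]_(t in `[0%R, T])
     (q (\matrix_(k < p.+1) x k t))%:E)%E.

Definition ocp_optimal (rho : R) (q : 'M[R]_(p.+1, 3) -> R)
    (c : 'rV[R]_3 -> R) (x0 : 'M[R]_(p, 3)) (rf vf : 'rV[R]_3)
    (T : R) (x : nat -> R -> 'rV[R]_3) : Prop :=
  ocp_feasible c x0 rf vf T x /\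
  forall T' x', ocp_feasible c x0 rf vf T' x' ->
    (ocp_cost rho q T x <= ocp_cost rho q T' x')%E.

End OptimalControl.

(* There are N = vg_len.+2 >= 2 waypoints; vg_mid is only used at the
   intermediate ones. *)
Record velocity_graph (R : realType) := VelocityGraph {
  vg_len : nat;
  vg_waypoint : 'I_vg_len.+2 -> 'rV[R]_3;
  vg_start_vel : 'rV[R]_3;
  vg_goal_vel : 'rV[R]_3;
  vg_mid : 'I_vg_len.+2 -> seq 'rV[R]_3
}.

Section VelocityGraph.
Context {R : realType} (G : velocity_graph R).

Definition vg_velocities (i : 'I_(vg_len G).+2) : seq 'rV[R]_3 :=
  if i == ord0 then [:: vg_start_vel G]
  else if i == ord_max then [:: vg_goal_vel G]
  else vg_mid i.

(* A node carries the index of its waypoint rather than the position alone, so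
   that the ordering of the waypoints is meaningful even if two of them
   coincide in space. *)
Definition vg_node : Type :=
  {n : 'I_(vg_len G).+2 * 'rV[R]_3 | n.2 \in vg_velocities n.1}.

Definition vg_index (n : vg_node) : 'I_(vg_len G).+2 := (val n).1.
Definition vg_pos (n : vg_node) : 'rV[R]_3 := vg_waypoint (vg_index n).
Definition vg_vel (n : vg_node) : 'rV[R]_3 := (val n).2.

Lemma vg_goal_subproof : vg_goal_vel G \in vg_velocities ord_max.
Proof. by rewrite /vg_velocities eqxx mem_head. Qed.

Definition vg_goal : vg_node := exist _ (ord_max, vg_goal_vel G) vg_goal_subproof.

Definition vg_edge (n m : vg_node) : Prop :=
  vg_index m = (vg_index n).+1 :> nat.

Definition vg_cost (umax : 'I_3 -> R) (n m : vg_node) : R :=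
  min_time3 umax (vg_pos n) (vg_vel n) (vg_pos m) (vg_vel m).

(* The Bellman equation concerns the nodes other than the goal, which has no
   outgoing edge. *)
Definition is_cost_to_go (umax : 'I_3 -> R) (V : vg_node -> R) : Prop :=
  V vg_goal = 0 /\
  forall n, n <> vg_goal ->
    is_minimum [set vg_cost umax n m + V m | m in [set m | vg_edge n m]] (V n).

End VelocityGraph.

(* Row k of mp_state n is the k-th derivative stored in n.  As for the
   underlying control problem, an edge constrains only the position and
   velocity at its target. *)
Record motion_primitive_graph (R : realType) (p : nat) (rho : R)
    (q : 'M[R]_(p.+1, 3) -> R) (c : 'rV[R]_3 -> R) (G : velocity_graph R) :=
  MotionPrimitiveGraph {
  mp_node : finType;
  mp_edge : finType;
  mp_state : mp_node -> 'M[R]_(p, 3);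
  mp_proj : mp_node -> vg_node G;
  mp_src : mp_edge -> mp_node;
  mp_tgt : mp_edge -> mp_node;
  mp_time : mp_edge -> R;
  mp_traj : mp_edge -> nat -> R -> 'rV[R]_3;
  mp_state_pos : forall n (k : 'I_p), k = 0%N :> nat ->
    row k (mp_state n) = vg_pos (mp_proj n);
  mp_state_vel : forall n (k : 'I_p), k = 1%N :> nat ->
    row k (mp_state n) = vg_vel (mp_proj n);
  mp_edge_next : forall e, vg_edge (mp_proj (mp_src e)) (mp_proj (mp_tgt e));
  mp_edge_optimal : forall e,
    ocp_optimal rho q c (mp_state (mp_src e))
      (vg_pos (mp_proj (mp_tgt e))) (vg_vel (mp_proj (mp_tgt e)))
      (mp_time e) (mp_traj e)
}.

Section Search.
Context {R : realType} {p : nat} {rho : R} {q : 'M[R]_(p.+1, 3) -> R}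
  {c : 'rV[R]_3 -> R} {G : velocity_graph R}
  (M : motion_primitive_graph rho q c G).

Definition mp_cost (e : mp_edge M) : \bar R :=
  ocp_cost rho q (mp_time e) (mp_traj e).

Fixpoint mp_path (n : mp_node M) (es : seq (mp_edge M)) (m : mp_node M)
    : Prop :=
  if es is e :: es' then mp_src e = n /\ mp_path (mp_tgt e) es' m else n = m.

Definition mp_goal (m : mp_node M) : Prop := mp_proj m = vg_goal G.

(* The infimum of the empty set is +oo.  Edges join consecutive waypoints, so
   there are finitely many paths and the infimum over a nonempty set of paths
   is a minimum. *)
Definition mp_optimal_cost (n : mp_node M) : \bar R :=
  ereal_inf [set (\sum_(e <- es) mp_cost e)%E |
    es in [set es | exists2 m, mp_path n es m & mp_goal m]].

Definition admissible (h : mp_node M -> R) : Prop :=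
  forall n, ((h n)%:E <= mp_optimal_cost n)%E.

End Search.

(* Main.v *)
Require Import Defs.
From mathcomp Require Import all_boot all_order all_algebra.
From mathcomp Require Import all_classical all_reals all_analysis.
From mathcomp Require Import measurable_realfun.
Import Order.TTheory GRing.Theory Num.Theory.
Import numFieldNormedType.Exports.
Set Implicit Arguments.
Unset Strict Implicit.
Local Open Scope classical_set_scope.
Local Open Scope ring_scope.

(** Restricted to one axis, a trajectory feasible for (P) has acceleration
    bounded by [umax], so it is feasible for (D) with the same duration: the
    minimum time of (D) is at most the duration [T] of the primitive. Since
    [q >= 0] and [rho > 1], [T] is at most the cost of the primitive. The edge
    costs of [G] thus bound from below those of the primitives lying above
    them, and the Bellman inequality is summed along a path to the goal. *)

Lemma lipschitz_absolutely_continuous (R : realType) (a b K : R) (f : R -> R) :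
  (forall s t, a <= s -> s <= t -> t <= b -> `|f t - f s| <= K * (t - s)) ->
  absolutely_continuous a b f.
Proof.
move=> lipf e e0; have K1 : 0 < `|K| + 1 by rewrite ltr_wpDl.
(* The sign of [K] is unconstrained, so the positive constant [|K| + 1] replaces it in the
   divisor. *)
exists (e / (`|K| + 1)); first exact: divr_gt0.
move=> n l r lr _ sum_lt.
apply: (@le_lt_trans _ _ ((`|K| + 1) * \sum_(i < n) (r i - l i))); last first.
  by rewrite mulrC -ltr_pdivlMr.
rewrite mulr_sumr; apply: ler_sum => i _; have [al [lri rb]] := lr i.
apply: le_trans (lipf _ _ al lri rb) _; apply: ler_wpM2r; first by rewrite subr_ge0.
by apply: le_trans (ler_norm K) _; rewrite lerDl.
Qed.

(** By compactness [|df|] attains a maximum on the closed interval, which by the mean value theorem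
    is a Lipschitz constant for [f]. *)
Lemma continuously_derivable_absolutely_continuous (R : realType) (a b : R)
    (f df : R -> R) : a <= b ->
  {within `[a, b], continuous f} -> {within `[a, b], continuous df} ->
  (forall t, a < t < b -> is_derive t 1 f (df t)) ->
  absolutely_continuous a b f.
Proof.
move=> ab cf cdf fdf.
have cndf : {within `[a, b], continuous (Num.norm \o df)}.
  by apply: within_continuous_comp cdf => y _; exact: norm_continuous.
have [m _ dfm] := EVT_max ab cndf.
apply: (@lipschitz_absolutely_continuous _ _ _ `|df m|) => s t sa st tb.
have [x||x] := @MVT_segment R f df s t st.
- rewrite in_itv /= => /andP[sx xt]; apply: fdf.
  by rewrite (le_lt_trans sa sx) (lt_le_trans xt tb).
- apply: continuous_subspaceW cf => x /=; rewrite !in_itv /= => /andP[sx xt].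
  by rewrite (le_trans sa sx) (le_trans xt tb).
- rewrite in_itv /= => /andP[sx xt] ->.
  rewrite normrM (ger0_norm (_ : 0 <= t - s)) ?subr_ge0//.
  apply: ler_wpM2r; first by rewrite subr_ge0.
  by apply: dfm; rewrite in_itv /= (le_trans sa sx) (le_trans xt tb).
Qed.

(* For [2 < p] the acceleration is a continuous state rather than the control,
   so the absolute continuity of the velocity has to be recovered. *)
Lemma integrator_chain_double (R : realType) (p : nat) (T : R)
    (x : nat -> R -> R) : (2 <= p)%N -> 0 <= T ->
  integrator_chain p T x -> integrator_chain 2 T x.
Proof.
rewrite leq_eqVlt => /predU1P[<-//|p2] T0 [cx dx _ _ _].
have dx1 (t : R) : 0 < t < T -> is_derive t 1 (x 1%N) (x 2%N t) by exact: dx.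
split => //.
- by move=> k k2; apply: cx; exact: leq_trans k2 (ltnW p2).
- by move=> k t k2; apply: dx; exact: leq_trans k2 (ltnW p2).
- apply: continuously_derivable_absolutely_continuous dx1 => //.
    exact/cx/(leq_trans _ p2).
  exact: cx.
(* The acceleration [x 2] now plays the role of the control. *)
- by apply: subspace_continuous_measurable_fun => //; exact: cx.
- exact: aeW.
Qed.

(** Durations are nonnegative, so [0] bounds the set below and its real infimum is a genuine lower
    bound. *)
Lemma min_time_le (R : realType) (umax s0 v0 sf vf T : R) :
  double_integrator_time umax s0 v0 sf vf T -> min_time umax s0 v0 sf vf <= T.
Proof. by move=> dT; apply: ge_inf => //; exists 0 => t []. Qed.

Section MinTimeOfPrimitive.
Context {R : realType} {p : nat} (p_ge2 : (2 <= p)%N).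
Context {c : 'rV[R]_3 -> R} {umax : 'I_3 -> R}.
Hypothesis acc_le : forall (a : 'rV[R]_3) i, c a <= 0 -> `|a 0 i| <= umax i.

Lemma min_time3_le (x0 : 'M[R]_(p, 3)) (r0 v0 rf vf : 'rV[R]_3) (T : R)
    (x : nat -> R -> 'rV[R]_3) :
  (forall k : 'I_p, k = 0%N :> nat -> row k x0 = r0) ->
  (forall k : 'I_p, k = 1%N :> nat -> row k x0 = v0) ->
  ocp_feasible c x0 rf vf T x -> min_time3 umax r0 v0 rf vf <= T.
Proof.
move=> row0 row1 [T0 chain cx init [xT vT]].
(* The base value [0] of the maximum is at most [T] by [T0], which leaves one inequality per
   axis. *)
apply/bigmax_leP; split=> // i _; apply: min_time_le; split=> //.
exists (fun k t => x k t 0 i); split.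
- exact: integrator_chain_double (chain i).
- by apply: (@filterS _ _ (ae_filter_ringOfSetsType _) _ _ _ cx) => t ct /ct; exact: acc_le.
(* Since [2 <= p], the indices 0 and 1 are rows of [x0]. *)
- rewrite -(row0 (Ordinal (ltnW p_ge2)))// -(row1 (Ordinal p_ge2))//.
  by rewrite -!init.
- by rewrite xT vT.
Qed.

End MinTimeOfPrimitive.

Lemma ocp_cost_ge (R : realType) (p : nat) (rho : R) (q : 'M[R]_(p.+1, 3) -> R)
    (T : R) (x : nat -> R -> 'rV[R]_3) :
  1 <= rho -> positive_definite q -> 0 <= T -> (T%:E <= ocp_cost rho q T x)%E.
Proof.
move=> rho1 [q0 qpos] T0; rewrite -[T%:E]adde0 /ocp_cost; apply: leeD.
  by rewrite lee_fin ler_peMl.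
apply: integral_ge0 => t _; rewrite lee_fin.
by have [->|/qpos/ltW//] := eqVneq (\matrix_(k < p.+1) x k t) 0; rewrite q0.
Qed.

Lemma cost_to_go_le (R : realType) (G : velocity_graph R) (umax : 'I_3 -> R)
    (V : vg_node G -> R) (n m : vg_node G) :
  is_cost_to_go umax V -> vg_edge n m -> V n <= vg_cost umax n m + V m.
Proof.
(* The goal has the last waypoint index, so an edge leaving it would end at an index out of range;
   hence the Bellman equation applies at [n]. *)
move=> [_ bellman] nm; have n_goal : n <> vg_goal G.
  by move=> ng; have := ltn_ord (vg_index m); rewrite nm ng ltnn.
by have [_] := bellman n n_goal; apply; exists m.
Qed.

Theorem theorem1 (R : realType) (p : nat) (hp : (2 <= p)%N)
    (rho : R) (hrho : 1 < rho)
    (q : 'M[R]_(p.+1, 3) -> R) (hq : positive_definite q)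
    (c : 'rV[R]_3 -> R)
    (umax : 'I_3 -> R) (umax_gt0 : forall i : 'I_3, 0 < umax i)
    (umax_max : forall i : 'I_3,
       is_maximum [set `|a 0 i| | a in [set a : 'rV[R]_3 | c a <= 0]] (umax i))
    (G : velocity_graph R)
    (M : motion_primitive_graph rho q c G)
    (V : vg_node G -> R) (hV : is_cost_to_go umax V) :
  admissible (fun n : mp_node M => V (mp_proj n)).
Proof.
have acc_le (a : 'rV[R]_3) i : c a <= 0 -> `|a 0 i| <= umax i.
  by move=> ca; apply: (umax_max i).2; exists a.
have edge_le (e : mp_edge M) :
    ((vg_cost umax (mp_proj (mp_src e)) (mp_proj (mp_tgt e)))%:E <= mp_cost e)%E.
  have [feas _] := mp_edge_optimal e; have [T0 _ _ _ _] := feas.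
  apply: le_trans (ocp_cost_ge _ (ltW hrho) hq T0); rewrite lee_fin.
  apply: min_time3_le feas => //; [exact: mp_state_pos | exact: mp_state_vel].
(* It suffices to bound the cost of each path to a goal node; without such a path the infimum is
   [+oo]. *)
move=> n; apply: le_ereal_inf_tmp => _ [es [m path_es goal_m] <-].
(* The start node is generalized, since the tail of the path starts at [mp_tgt e]. *)
elim: es n path_es => [n /= ->|e es IH n /= [<- path_es]].
  by rewrite goal_m hV.1 big_nil.
rewrite big_cons; apply: le_trans (leeD (edge_le e) (IH _ path_es)).
by rewrite -EFinD lee_fin; apply: cost_to_go_le hV _; exact: mp_edge_next.
Qed.
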